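(* Let $(V,\nu)$ be a fuzzy antinormed linear space with respect to a t-conorm $\diamond$, and assume that (a) for every $x\in V$, if $\nu(x,t)<1$ for all $t>0$ then $x=\theta$; and (b) $a\diamond a=a$ for all $a\in[0,1]$. Let $\alpha\in(0,1)$ and $\|x\|_\alpha^{*}=\inf\{t>0:\nu(x,t)\le 1-\alpha\}$ for $x\in V$. If $(x_n)_{n\in\mathbb{N}}$ is a fuzzy $\alpha$-anti-convergent sequence in $(V,\nu)$ which fuzzy $\alpha$-anti-converges to $x$, then $\|x_n-x\|_\alpha^{*}\to 0$ as $n\to\infty$.
   Context: $V$ is a linear space over $F$ ($F=\mathbb{R}$ or $\mathbb{C}$), and $\theta$ is its zero vector. A t-conorm is a map $\diamond:[0,1]\times[0,1]\to[0,1]$ that is commutative, associative, continuous, satisfies $a\diamond 0=a$ for all $a$, and satisfies $a\diamond b\le c\diamond d$ whenever $a\le c$, $b\le d$. A fuzzy antinorm on $V$ with respect to $\diamond$ is a function $\nu:V\times\mathbb{R}\to[0,1]$ such that for all $x,y\in V$: (i) $\nu(x,t)=1$ for all $t\le 0$; (ii) $\nu(x,t)=0$ for all $t>0$ if and only if $x=\theta$; (iii) $\nu(cx,t)=\nu(x,t/|c|)$ for all $t>0$ and $c\in F$, $c\ne 0$; (iv) $\nu(x+y,s+t)\le\nu(x,s)\diamond\nu(y,t)$ for all $s,t\in\mathbb{R}$; (v) $\lim_{t\to\infty}\nu(x,t)=0$. The pair $(V,\nu)$ is then called a fuzzy antinormed linear space with respect to $\diamond$. For $\alpha\in(0,1)$,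 a sequence $(x_n)$ in $V$ is fuzzy $\alpha$-anti-convergent if there exists $x\in V$ such that $\lim_{n\to\infty}\nu(x_n-x,t)<1-\alpha$ for all $t>0$; one then says that $(x_n)$ fuzzy $\alpha$-anti-converges to $x$. *)

(* Defs.v *)
From HB Require Import structures.
From mathcomp Require Import all_boot all_order all_algebra.
From mathcomp Require Import complex.
From mathcomp Require Import all_classical all_reals all_analysis.

Set Implicit Arguments.
Unset Strict Implicit.
Unset Printing Implicit Defensive.

Import Order.TTheory GRing.Theory Num.Theory.
Import numFieldNormedType.Exports.

Local Open Scope classical_set_scope.
Local Open Scope ring_scope.

Inductive scalar_kind : Set := RealScalars | ComplexScalars.

Definition scalar_field (R : realType) (k : scalar_kind) : numFieldType :=
  match k with
  | RealScalars => R
  | ComplexScalars => R[i]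
  end.

(* The library norm of [R[i]] takes its values in [R[i]], whereas the modulus
   is needed as a real number. *)
Definition scalar_abs (R : realType) (k : scalar_kind) : scalar_field R k -> R :=
  match k return scalar_field R k -> R with
  | RealScalars => fun c : R => `|c|
  | ComplexScalars => fun c : R[i] => ComplexField.Normc.normc c
  end.

(* Functions on [0, 1] are represented by total functions on [R] whose values
   outside [0, 1] are irrelevant. *)
Record t_conorm (R : realType) (op : R -> R -> R) : Prop := TConorm {
  t_conorm_closed : forall a b : R,
    0 <= a <= 1 -> 0 <= b <= 1 -> 0 <= op a b <= 1;
  t_conormC : forall a b : R,
    0 <= a <= 1 -> 0 <= b <= 1 -> op a b = op b a;
  t_conormA : forall a b c : R,
    0 <= a <= 1 -> 0 <= b <= 1 -> 0 <= c <= 1 ->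
    op a (op b c) = op (op a b) c;
  t_conorm_continuous :
    {within [set` `[(0 : R), 1]] `*` [set` `[(0 : R), 1]],
      continuous (fun p : R * R => op p.1 p.2)};
  t_conorm0 : forall a : R, 0 <= a <= 1 -> op a 0 = a;
  t_conorm_le : forall a b c d : R,
    0 <= a <= 1 -> 0 <= b <= 1 -> 0 <= c <= 1 -> 0 <= d <= 1 ->
    a <= c -> b <= d -> op a b <= op c d
}.

Record fuzzy_antinorm (R : realType) (k : scalar_kind)
    (V : lmodType (scalar_field R k)) (op : R -> R -> R) (nu : V -> R -> R) : Prop :=
  FuzzyAntinorm {
  antinorm01 : forall (x : V) (t : R), 0 <= nu x t <= 1;
  antinorm_npos : forall (x : V) (t : R), t <= 0 -> nu x t = 1;
  antinorm_eq0 : forall x : V, (forall t : R, 0 < t -> nu x t = 0) <-> x = 0;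
  antinormZ : forall (x : V) (c : scalar_field R k) (t : R),
    0 < t -> c != 0 -> nu (c *: x) t = nu x (t / scalar_abs c);
  antinormD : forall (x y : V) (s t : R),
    nu (x + y) (s + t) <= op (nu x s) (nu y t);
  antinorm_cvg0 : forall x : V, nu x t @[t --> +oo] --> (0 : R)
}.

Section AntiConvergence.
Variables (R : realType) (k : scalar_kind) (V : lmodType (scalar_field R k)).
Variables (nu : V -> R -> R) (alpha : R).

Definition fuzzy_anti_converges_to (u : nat -> V) (x : V) : Prop :=
  forall t : R, 0 < t ->
    cvgn (fun n => nu (u n - x) t) /\
    limn (fun n => nu (u n - x) t) < 1 - alpha.

Definition fuzzy_anti_convergent (u : nat -> V) : Prop :=
  exists x : V, fuzzy_anti_converges_to u x.

Definition alpha_norm (x : V) : R :=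
  inf [set t : R | 0 < t /\ nu x t <= 1 - alpha].

End AntiConvergence.

(* Main.v *)
Require Import Defs.
From HB Require Import structures.
From mathcomp Require Import all_boot all_order all_algebra.
From mathcomp Require Import complex.
From mathcomp Require Import all_classical all_reals all_analysis.

Set Implicit Arguments.
Unset Strict Implicit.
Unset Printing Implicit Defensive.

Import Order.TTheory GRing.Theory Num.Theory.
Import numFieldNormedType.Exports.

Local Open Scope classical_set_scope.
Local Open Scope ring_scope.

(** The alpha-norm of a vector is the infimum of the levels [t > 0] at which its
    antinorm has dropped to [1 - alpha] or below, so a single such level bounds
    it from above ([alpha_norm_le]).  Given [e > 0], anti-convergence at the
    level [e / 2] says that [nu (u n - x) (e / 2)] has a limit strictly below
    [1 - alpha]; hence this value is itself below [1 - alpha] for all large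
    [n], so that [e / 2] is a level of the required kind for [u n - x] and its
    alpha-norm lies in [[0, e / 2]].  The strictness of the bound on the limit
    is what lets it pass to the terms of the sequence. *)

Section AlphaNorm.
Variables (R : realType) (k : scalar_kind) (V : lmodType (scalar_field R k)).
Variables (nu : V -> R -> R) (alpha : R).

Lemma alpha_norm_le (x : V) (t : R) :
  0 < t -> nu x t <= 1 - alpha -> alpha_norm nu alpha x <= t.
Proof.
move=> t_gt0 nu_le; apply: ge_inf; last by split.
by exists 0 => s [/ltW].
Qed.

Lemma alpha_norm_ge0 (x : V) : 0 <= alpha_norm nu alpha x.
Proof.
rewrite /alpha_norm.
(* The infimum of the empty set of reals is 0 by convention. *)
have [->|/set0P A0] := eqVneq [set t : R | 0 < t /\ nu x t <= 1 - alpha] set0.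
  by rewrite inf0.
by apply: lb_le_inf => // s [/ltW].
Qed.

Lemma near_anti_converges_to (u : nat -> V) (x : V) (t : R) :
  fuzzy_anti_converges_to nu alpha u x -> 0 < t ->
  \forall n \near \oo, nu (u n - x) t < 1 - alpha.
Proof. by move=> u_to_x /u_to_x[u_cvg lim_lt]; exact: (cvgr_lt _ u_cvg). Qed.

End AlphaNorm.

Theorem theorem4p4 (R : realType) (k : scalar_kind)
    (V : lmodType (scalar_field R k)) (op : R -> R -> R) (nu : V -> R -> R)
    (op_conorm : t_conorm op)
    (nu_antinorm : fuzzy_antinorm op nu)
    (nu_lt1_eq0 : forall x : V, (forall t : R, 0 < t -> nu x t < 1) -> x = 0)
    (op_idem : forall a : R, 0 <= a <= 1 -> op a a = a)
    (alpha : R) (alpha_gt0 : 0 < alpha) (alpha_lt1 : alpha < 1)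
    (u : nat -> V) (x : V)
    (u_convergent : fuzzy_anti_convergent nu alpha u)
    (u_to_x : fuzzy_anti_converges_to nu alpha u x) :
  (fun n : nat => alpha_norm nu alpha (u n - x)) @ \oo --> (0 : R).
Proof.
apply/cvgr0Pnorm_lt => e e_gt0.
have e2_gt0 : 0 < e / 2 by rewrite divr_gt0.
apply: filterS (near_anti_converges_to u_to_x e2_gt0) => n /ltW nu_le.
rewrite ger0_norm ?alpha_norm_ge0//.
(* Halving [e] turns the non-strict bound by a level into a strict one. *)
apply: le_lt_trans (alpha_norm_le e2_gt0 nu_le) _.
by rewrite ltr_pdivrMr// ltr_pMr// ltr1n.
Qed.
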